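(* Let $u<\widetilde u$, and let $\widetilde\kappa=\widetilde\kappa(u)\in(0,1)$ be an exponent such that, for some positive $c_6(u),c_7(u)$, $$\sup_{\mathcal P,\,x\in\mathcal P}\ \mathbb P\big[B(x,L)\stackrel{*-\mathcal I^u\cap\mathcal P}{\longleftrightarrow}\partial_{\rm int}B(x,2L)\big]\le c_6\,e^{-c_7L^{\widetilde\kappa}}\quad\text{for all }L\ge1.$$ Then there exist positive $c_8(u)$, $c_9(u)$ such that $$\sup_{\mathcal P,\,x\in\mathcal P}\ \mathbb P\big[\text{the connected component of }x\text{ in }\mathcal V^u\cap\mathcal P\text{ is finite and intersects }\partial_{\rm int}B(x,L)\big]\le c_8\,e^{-c_9L^{\widetilde\kappa}}\quad\text{for all }L\ge1,$$ where the suprema are over all half-planes $\mathcal P$ and all $x\in\mathcal P$.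
   Context: Setting. $G$ is an infinite connected graph of bounded degree (countable vertex set), with graph distance $d_G$ and closed balls $B_G(y,r)$, endowed with a weight $\rho^G$: a symmetric non-negative function on $G\times G$ with $\rho^G_{y,y'}>0$ iff $y\sim y'$ (neighbors), such that $\rho^G_{y,y'}$ is uniformly bounded and uniformly positive over edges. Write $\rho^G(y)=\sum_{y'\sim y}\rho^G_{y,y'}$, $\rho^G(U)=\sum_{y\in U}\rho^G(y)$. Assume for some $\alpha>1$ that $cR^\alpha\le\rho^G(B_G(y,R))\le c'R^\alpha$ for all $R\ge\frac12$, $y\in G$ ($c,c'$ positive constants). $E=G\times\mathbb Z$ is the graph in which $(y,z)\sim(y',z')$ iff ($y\sim y'$ and $z=z'$) or ($y=y'$ and $|z-z'|=1$), with weights $\rho_{x,x'}=\rho^G_{y,y'}$ on the first type of edges, $1$ on the second type, $0$ otherwise; $\rho(x)=\sum_{x'\sim x}\rho_{x,x'}$. $P_x$ is the law of the walk $(X_n)_{n\ge0}$ on $E$ started at $x$ with transition probability $\rho_{x,x'}/\rho(x)$, and $g(x,x')=\sum_{n\ge0}P_x[X_n=x']/\rho(x')$ is the Green density. Assume there is $\beta\in[2,1+\alpha]$ such that, with $\nu=\alpha-\frac\beta2>0$ and $d(x,x')=\max\{d_G(y,y'),|z-z'|^{2/\beta}\}$ for $x=(y,z),x'=(y',z')$, one has $c(d(x,x')\vee1)^{-\nu}\le g(x,x')\le c'(d(x,x')\vee1)^{-\nu}$ for all $x,x'\in E$. $B(x,r)$ is the closed $d$-ball in $E$. For $U\subseteq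 E$, $\partial_{\rm int}U$ is the set of points of $U$ having a neighbor (in the graph $E$) in $U^c$. Interlacements. For finite $K\subset E$, $\mathrm{cap}(K)=\sum_{x\in K}P_x[X_n\notin K\text{ for all }n\ge1]\,\rho(x)$. On a probability space $(\Omega,\mathcal A,\mathbb P)$ one has the random interlacements $\mathcal I^u\subseteq E$, $u\ge0$ (non-decreasing in $u$), the law of $\mathcal I^u$ being characterized by $\mathbb P[\mathcal I^u\cap K=\emptyset]=e^{-u\,\mathrm{cap}(K)}$ for all finite $K\subset E$; $\mathcal V^u=E\setminus\mathcal I^u$. Half-planes. A half-plane is a set $\mathcal P=\{y(n):n\ge0\}\times\mathbb Z\subseteq E$, where $y(n)$, $n\ge0$, is a semi-infinite geodesic in $G$: $d_G(y(n),y(m))=|n-m|$ for all $n,m\ge0$. A $*$-path in $\mathcal P$ is a finite sequence $x_0,\dots,x_N$ in $\mathcal P$ such that for each $0\le i<N$, $x_i\ne x_{i+1}$, the $G$-projections of $x_i,x_{i+1}$ are at $d_G$-distance at most $1$, and their $\mathbb Z$-projections are at distance at most $1$. $\{B(x,L)\stackrel{*-\mathcal I^u\cap\mathcal P}{\longleftrightarrow}\partial_{\rm int}B(x,2L)\}$ is the event that there is a $*$-path in $\mathcal P$, all of whose points lie in $\mathcal I^u$, from $B(x,L)$ to $\partial_{\rm int}B(x,2L)$. Finally $$\widetilde u=\inf\Big\{u\ge0:\ \liminf_{L\to\infty}\ \sup_{\mathcal P,\,x\in\mathcal P}\mathbb P\big[B(x,L)\stackrel{*-\mathcal I^u\cap\mathcal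 P}{\longleftrightarrow}\partial_{\rm int}B(x,2L)\big]>0\Big\}.$$ It is known (proved separately in the same work) that for every $u<\widetilde u$ an exponent $\widetilde\kappa(u)\in(0,1)$ and constants $c_6(u),c_7(u)$ as in the claim exist. *)

(* Defs.v *)
From HB Require Import structures.
From mathcomp Require Import all_boot all_order all_algebra.
From mathcomp Require Import all_classical all_reals all_analysis.
Import Order.TTheory GRing.Theory Num.Theory.
Import numFieldNormedType.Exports.

Set Implicit Arguments.
Unset Strict Implicit.
Unset Printing Implicit Defensive.

Local Open Scope classical_set_scope.
Local Open Scope ring_scope.

Section Graphs.
Context {R : realType} {T : countType}.
Implicit Types (e : rel T) (w : T -> T -> R) (S U : set T).

Definition has_walk e (x y : T) (n : nat) : bool :=
  `[< exists p : seq T, [/\ path e x p, last x p = y & size p = n] >].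

(* The value 0 for unconnected points is junk: graphs below are connected. *)
Definition graph_dist e (x y : T) : nat :=
  if pselect (exists n, has_walk e x y n) is left h then ex_minn h else 0%N.

(* In particular both x and y have to belong to S. *)
Definition joined_in e S (x y : T) : Prop :=
  exists p : seq T,
    [/\ path e x p, last x p = y & forall z, z \in x :: p -> S z].

(* This is empty when x is not in S. *)
Definition component e S (x : T) : set T := [set y | joined_in e S x y].

Definition interior_boundary e U : set T :=
  [set x | U x /\ exists2 x', e x x' & ~ U x'].

Definition graph_ball e (x : T) (r : R) : set T :=
  [set y | (graph_dist e x y)%:R <= r].

(* The sum over a classical set is meant for finite neighborhoods; graphs
   below have bounded degree. *)
Definition vertex_weight e w (x : T) : R := \sum_(x' \in [set` e x]) w x x'.

Definition set_weight e w U : \bar R :=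
  \esum_(x in U) (vertex_weight e w x)%:E.

Record infinite_bounded_degree_graph e : Prop := {
  graph_infinite : infinite_set [set: T];
  graph_irrefl : irreflexive e;
  graph_sym : symmetric e;
  graph_connected : forall x y, exists n, has_walk e x y n;
  graph_bounded_degree : exists D : nat, forall x, ([set` e x] #<= `I_D)%card
}.

Record elliptic_weight e w : Prop := {
  weight_sym : forall x y, w x y = w y x;
  weight_ge0 : forall x y, 0 <= w x y;
  weight_gt0 : forall x y, 0 < w x y <-> e x y;
  weight_bounded : exists C : R, forall x y, e x y -> w x y <= C;
  weight_bounded_below : exists c : R, 0 < c /\ forall x y, e x y -> c <= w x y
}.

Definition volume_growth e w (alpha : R) : Prop :=
  exists c c' : R, [/\ 0 < c, 0 < c' & forall (y : T) (r : R), 2^-1 <= r ->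
    ((c * r `^ alpha)%:E <= set_weight e w (graph_ball e y r))%E /\
    (set_weight e w (graph_ball e y r) <= (c' * r `^ alpha)%:E)%E].

End Graphs.

Section Walks.
Context {R : realType} {T : countType} {d : measure_display}
  {W : measurableType d}.
Implicit Types (e : rel T) (w : T -> T -> R).

Record is_random_walk e w (P : T -> probability W R) (X : nat -> W -> T)
    : Prop := {
  walk_measurable : forall (n : nat) (x : T), measurable [set o | X n o = x];
  walk_law : forall (x : T) (n : nat) (s : nat -> T),
    P x [set o | forall i, (i <= n)%N -> X i o = s i] =
    ((s 0%N == x)%:R *
     \prod_(i < n) (w (s i) (s i.+1) / vertex_weight e w (s i)))%:E
}.

Definition green e w (P : T -> probability W R) (X : nat -> W -> T)
    (x x' : T) : \bar R :=
  (\sum_(0 <= n <oo)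
     P x [set o | X n o = x'] * ((vertex_weight e w x')^-1)%:E)%E.

Definition capacity e w (P : T -> probability W R) (X : nat -> W -> T)
    (K : set T) : R :=
  \sum_(x \in K)
    fine (P x [set o | forall n, (1 <= n)%N -> ~ K (X n o)]) *
    vertex_weight e w x.

Record are_interlacements (cap : set T -> R) (P : probability W R)
    (I : R -> W -> set T) : Prop := {
  interlacement_measurable : forall (u : R) (x : T), 0 <= u ->
    measurable [set o | I u o x];
  interlacement_mono : forall (u v : R) (o : W), 0 <= u -> u <= v ->
    I u o `<=` I v o;
  interlacement_law : forall (u : R) (K : set T), 0 <= u -> finite_set K ->
    P [set o | I u o `&` K = set0] = (expR (- (u * cap K)))%:E
}.

End Walks.

Section Product.
Context {R : realType} {G : countType}.
Implicit Types (adj : rel G) (rho : G -> G -> R).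

Local Notation E := (G * int)%type.
Implicit Types (x : E) (S Q : set E).

Definition prod_adj adj : rel E := fun x x' =>
  (adj x.1 x'.1 && (x.2 == x'.2)) ||
  ((x.1 == x'.1) && (`|x.2 - x'.2| == 1)).

Definition prod_weight adj rho x x' : R :=
  if adj x.1 x'.1 && (x.2 == x'.2) then rho x.1 x'.1
  else if (x.1 == x'.1) && (`|x.2 - x'.2| == 1) then 1 else 0.

Definition prod_dist adj (beta : R) x x' : R :=
  Num.max (graph_dist adj x.1 x'.1)%:R (`|x.2 - x'.2|%:~R `^ (2 / beta)).

Definition dist_ball adj (beta : R) x (r : R) : set E :=
  [set x' | prod_dist adj beta x x' <= r].

Definition green_bounds adj (beta nu : R) (g : E -> E -> \bar R) : Prop :=
  exists c c' : R, [/\ 0 < c, 0 < c' & forall x x',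
    ((c * Num.max (prod_dist adj beta x x') 1 `^ (- nu))%:E <= g x x')%E /\
    (g x x' <= (c' * Num.max (prod_dist adj beta x x') 1 `^ (- nu))%:E)%E].

Definition geodesic_ray adj (y : nat -> G) : Prop :=
  forall n m : nat, graph_dist adj (y n) (y m) = `|n%:Z - m%:Z|%N.

Definition half_plane adj Q : Prop :=
  exists2 y : nat -> G, geodesic_ray adj y & Q = range y `*` [set: int].

Definition star_adj adj : rel E := fun x x' =>
  [&& x != x', (graph_dist adj x.1 x'.1 <= 1)%N & `|x.2 - x'.2| <= 1].

(* There is a *-path inside S from B(x,L) to the interior boundary of B(x,2L);
   it is used with S contained in a half-plane. *)
Definition star_crossing adj (beta : R) S x (L : R) : Prop :=
  exists a b, [/\ dist_ball adj beta x L a,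
    interior_boundary (prod_adj adj) (dist_ball adj beta x (2 * L)) b &
    joined_in (star_adj adj) S a b].

Definition finite_component_reaches adj (beta : R) S x (L : R) : Prop :=
  finite_set (component (prod_adj adj) S x) /\
  component (prod_adj adj) S x `&`
    interior_boundary (prod_adj adj) (dist_ball adj beta x L) !=set0.

Definition sup_half_planes adj (f : set E -> E -> \bar R) : \bar R :=
  ereal_sup [set p | exists Q x, [/\ half_plane adj Q, Q x & p = f Q x]].

Section Percolation.
Context {d : measure_display} {Omega : measurableType d}.
Variables (adj : rel G) (beta : R) (P : probability Omega R)
  (I : R -> Omega -> set E).

Definition sup_star_crossing (u L : R) : \bar R :=
  sup_half_planes adj (fun Q x =>
    P [set o | star_crossing adj beta (I u o `&` Q) x L]).

Definition sup_finite_component (u L : R) : \bar R :=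
  sup_half_planes adj (fun Q x =>
    P [set o | finite_component_reaches adj beta (~` I u o `&` Q) x L]).

Definition u_tilde : \bar R :=
  ereal_inf [set u%:E | u in [set u : R | 0 <= u /\
    (0 < limf_einf (sup_star_crossing u) (pinfty_nbhs R))%E]].

End Percolation.

End Product.

(* Main.v *)
(** If the component of x in the vacant set of a half-plane is finite, its outer
    boundary is a *-connected set of occupied points which meets the vertical
    rays going up and down, and the horizontal ray going right, from every point
    of the component. Suppose that it meets the upward ray from x at height k+1.
    It also meets the downward ray from x, at distance at least (k+1)^(2/beta)
    from the former point, and, as the component reaches distance L, it contains
    a point at distance at least L/2 from it. Hence a *-crossing occurs at that
    point at a scale of order max(L, (k+1)^(2/beta)), and summing the hypothesis
    over k gives the bound.

    That the boundary is *-connected comes from a Z/2 potential: if S is a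
    *-cluster of boundary points of C, then the edges from C to S form a cocycle
    of the quarter-plane grid, since no unit square has boundary points both in
    and outside S. So this cocycle is the coboundary of a function, which vanishes
    at infinity; when S contains the point above a topmost point of C, the
    function is 1 on all of C, and S separates C from infinity. *)

Require Import Defs.
From HB Require Import structures.
From mathcomp Require Import all_boot all_order all_algebra.
From mathcomp Require Import all_classical all_reals all_analysis.
From mathcomp Require Import zify ring lra.
Import Order.TTheory GRing.Theory Num.Theory.
Import numFieldNormedType.Exports.
Local Open Scope classical_set_scope.
Local Open Scope ring_scope.

(** * A mod 2 potential on the quarter-plane grid *)

Definition grid_adj (a b : nat * nat) : bool :=
  ((a.1 == b.1) && ((a.2 == b.2.+1) || (b.2 == a.2.+1))) ||
  ((a.2 == b.2) && ((a.1 == b.1.+1) || (b.1 == a.1.+1))).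

Definition king_near (a b : nat * nat) : bool :=
  [&& a.1 <= b.1.+1, b.1 <= a.1.+1, a.2 <= b.2.+1 & b.2 <= a.2.+1]%N.

(** Connectedness is encoded through locally constant functions, so that it applies directly to the
    potential [winding]. *)
Definition grid_connected (C : pred (nat * nat)) : Prop :=
  forall D : pred (nat * nat),
    (forall a b, C a -> C b -> grid_adj a b -> D a = D b) ->
    forall a b, C a -> C b -> D a = D b.

(** [S] need not consist of boundary points of [C]: it may be a whole cluster of occupied points, as
    long as it absorbs every boundary point near it. *)
Record boundary_closed (C S : pred (nat * nat)) : Prop := {
  boundary_disjoint : forall a, S a -> ~~ C a;
  boundary_propagate : forall a b c, S a -> king_near a b -> ~~ C b -> C c ->
    grid_adj b c -> S b
}.

Definition boundary_edge (C S : pred (nat * nat)) (a b : nat * nat) : bool :=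
  (C a && S b) || (C b && S a).

(* Parity of the number of boundary edges on the segment from (n, 0) to (n, j);
   row 0 lies above C. *)
Fixpoint winding (C S : pred (nat * nat)) (n j : nat) : bool :=
  if j is i.+1
  then winding C S n i (+) boundary_edge C S (n, i) (n, i.+1) else false.

(** Without a corner in [S] all four terms vanish. With one, every corner is near it, so [S] is the
    complement of [C] at each corner adjacent to a point of [C]; each term is then [C b (+) C c],
    and the sum around the square cancels. *)
Lemma boundary_edge_face C S n j : boundary_closed C S ->
  boundary_edge C S (n, j) (n, j.+1) (+) boundary_edge C S (n.+1, j) (n.+1, j.+1)
  = boundary_edge C S (n, j) (n.+1, j)
    (+) boundary_edge C S (n, j.+1) (n.+1, j.+1).
Proof.
case=> disj prop; rewrite /boundary_edge.
have [/existsP[a Sa]|noS] := boolP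
  [exists a : bool * bool, S (n + a.1, j + a.2)%N]; last first.
  have S0 (a1 a2 : bool) : S (n + a1, j + a2)%N = false.
    by apply/negP => Sa; move/existsP: noS => []; exists (a1, a2).
  have := (S0 false false, S0 false true, S0 true false, S0 true true).
  rewrite /= !addn0 !addn1 => -[[[-> ->] ->] ->].
  by rewrite !andbF.
have SE b c : king_near (n + a.1, j + a.2)%N b -> grid_adj b c ->
    C c -> S b = ~~ C b.
  move=> ab bc Cc; apply/idP/idP => [/disj//|Cb].
  exact: prop Sa ab Cb Cc bc.
have CE b c : king_near (n + a.1, j + a.2)%N b -> 
     king_near (n + a.1, j + a.2)%N c -> grid_adj b c -> grid_adj c b ->
    (C b && S c) || (C c && S b) = C b (+) C c.
  move=> ab ac bc cb; have := SE _ _ ab bc; have := SE _ _ ac cb.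
  case: (C b) (C c) => -[] /=; rewrite ?orbF; [|by move=> ->| by move=> _ ->|by []].
  by move=> -> // ->.
clear SE Sa.
case: a CE => a1 a2 /= CE; rewrite !CE ?/king_near ?/grid_adj /=; lia.
Qed.

(** Each unit square transfers the identity from one row to the next, starting from row 0, which
    misses [C]. *)
Lemma winding_horizontal C S n j : boundary_closed C S ->
  (forall n, ~~ C (n, 0)%N) ->
  winding C S n j (+) winding C S n.+1 j = boundary_edge C S (n, j) (n.+1, j).
Proof.
move=> CS row0; elim: j => [|j IH] /=.
  by rewrite /boundary_edge !(negbTE (row0 _)).
have := boundary_edge_face C S n j CS; rewrite -IH.
by do 2 case: (winding _ _ _ _); do 3 case: (boundary_edge _ _ _ _).
Qed.

Lemma winding_grid_adj C S a b : boundary_closed C S ->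
  (forall n, ~~ C (n, 0)%N) -> grid_adj a b ->
  winding C S a.1 a.2 (+) winding C S b.1 b.2 = boundary_edge C S a b.
Proof.
move=> CS row0; case: a b => [n i] [m j]; rewrite /grid_adj /=.
case/orP => /andP[/eqP->] /orP[] /eqP -> /=.
- by rewrite addbAC addbb /= /boundary_edge orbC.
- by rewrite addbA addbb.
- by rewrite addbC winding_horizontal// /boundary_edge orbC.
- by rewrite winding_horizontal.
Qed.

Lemma switch_point (f : nat -> bool) m n : (m <= n)%N -> f m -> ~~ f n ->
  exists2 i, (m <= i < n)%N & f i && ~~ f i.+1.
Proof.
move=> /subnK <-; elim: (n - m)%N => [|k IH] fm; first by rewrite add0n fm.
rewrite addSn => fk; have [fkm|fkm] := boolP (f (k + m)%N).
  by exists (k + m)%N; rewrite ?fkm ?fk//; lia.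
by have [i ? ?] := IH fm fkm; exists i => //; lia.
Qed.

(** [winding] vanishes far away and on row 0, but holds at [c] and hence on all of [C]. So it
    switches along each of the three rays, and only an edge with an end in [S] can switch it. No
    leftward ray appears, since [C] may touch column 0. *)
Lemma boundary_meets_rays (C S : pred (nat * nat)) (N : nat) (c : nat * nat) :
  boundary_closed C S -> grid_connected C ->
  (forall n, ~~ C (n, 0)%N) -> (forall a, C a -> (a.1 < N)%N /\ (a.2 < N)%N) ->
  C c -> (forall a, C a -> (c.2 <= a.2)%N) -> S (c.1, c.2.-1) ->
  forall a, C a ->
    [/\ exists2 j, (j < a.2)%N & S (a.1, j),
        exists2 j, (a.2 < j)%N & S (a.1, j) &
        exists2 n, (a.1 < n)%N & S (n, a.2)].
Proof.
move=> CS Ccon row0 bnd Cc ctop Sc.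
have edgeC a b : boundary_edge C S a b -> C a || C b.
  by case/orP => /andP[->]; rewrite ?orbT.
have far1 n j : (N <= n)%N -> winding C S n j = false.
  move=> Nn; elim: j => [//|j IH] /=; rewrite IH /=.
  by apply/negP => /edgeC /orP[] /bnd /=; lia.
(* A column left of [N] may meet [C]; the value is therefore carried leftwards from column [N] along
   row [j], which has no boundary edges. *)
have far2 n j : (N <= j)%N -> winding C S n j = false.
  move=> Nj; have [/far1//|nN] := leqP N n.
  rewrite -(subKn (ltnW nN)); elim: (N - n)%N => [|k IH].
    by rewrite subn0 far1.
  (* Past column 0, truncated subtraction makes both columns equal to 0. *)
  have [kN|Nk] := leqP k.+1 N; last first.
    by move: IH; rewrite (eqP (_ : N - k.+1 == N - k)%N)//; lia.
  have -> : winding C S (N - k.+1)%N j =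
      winding C S (N - k.+1)%N j (+) winding C S (N - k.+1).+1%N j.
    by rewrite subnSK// IH addbF.
  rewrite winding_horizontal//; apply/negP => /edgeC /orP[] /bnd /=; lia.
(* As [c] is topmost, the edge entering it from above is the only boundary edge counted. *)
have wc : winding C S c.1 c.2.
  have above j : (j < c.2)%N -> winding C S c.1 j = false.
    elim: j => [//|j IH jc] /=; rewrite IH//=; last exact: ltnW.
    by apply/negP => /edgeC /orP[] /ctop /=; lia.
  case: c Cc Sc above {ctop} => n [|j] /= Cc Sc above.
    by move: (row0 n); rewrite Cc.
  by rewrite above// /boundary_edge Cc Sc orbT.
have w1 a : C a -> winding C S a.1 a.2.
  move=> Ca; suff -> : winding C S a.1 a.2 = winding C S c.1 c.2 by [].
  apply: (Ccon (fun b => winding C S b.1 b.2)) => // {Ca}a b Ca Cb ab.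
  have e0 : boundary_edge C S a b = false.
    by apply/negP => /orP[] /andP[_ /(boundary_disjoint _ _ CS)]; rewrite ?Ca ?Cb.
  have := winding_grid_adj C S a b CS row0 ab; rewrite e0.
  by do 2 case: (winding _ _ _ _).
have edgeS a b : grid_adj a b -> winding C S a.1 a.2 -> ~~ winding C S b.1 b.2 ->
    S a || S b.
  move=> ab wa wb; have := winding_grid_adj C S a b CS row0 ab.
  rewrite wa (negbTE wb) => /esym /orP[] /andP[_ ->]//; by rewrite orbT.
move=> [n j] /[dup] Ca /w1 /= wa; have [/= nN jN] := bnd _ Ca.
(* If the switch occurs on the first edge of a ray, this forces the end in [S] to be the far one,
   which gives the strict inequalities. *)
have noS : ~~ S (n, j) by apply/negP => /(boundary_disjoint _ _ CS); rewrite Ca.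
split.
- have w0 : winding C S n (j - 0)%N by rewrite subn0.
  have wj : ~~ winding C S n (j - j)%N by rewrite subnn.
  have [i ij /andP[wi wi1]] :=
    switch_point (fun i => winding C S n (j - i)%N) 0 j (leq0n j) w0 wj.
  have adj : grid_adj (n, (j - i)%N) (n, (j - i.+1)%N).
    by clear -ij; rewrite /grid_adj /=; lia.
  case/orP: (edgeS _ _ adj wi wi1) => Sn; last first.
    by exists (j - i.+1)%N => //; clear -ij; lia.
  exists (j - i)%N => //; case: i ij Sn {wi wi1 adj} => [|i] ij Sn; last by clear -ij; lia.
  by move: Sn; rewrite subn0 (negbTE noS).
- have [i ij /andP[wi wi1]] := switch_point (fun i => winding C S n i) j N
    (ltnW jN) wa (negbT (far2 _ _ (leqnn N))).
  have adj : grid_adj (n, i) (n, i.+1) by clear -ij; rewrite /grid_adj /=; lia.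
  case/orP: (edgeS _ _ adj wi wi1) => Sn; last by exists i.+1 => //; clear -ij; lia.
  exists i => //; rewrite ltn_neqAle; apply/andP; split; last by clear -ij; lia.
  by apply: contra noS => /eqP ->.
- have [i ij /andP[wi wi1]] := switch_point (fun i => winding C S i j) n N
    (ltnW nN) wa (negbT (far1 _ _ (leqnn N))).
  have adj : grid_adj (i, j) (i.+1, j) by clear -ij; rewrite /grid_adj /=; lia.
  case/orP: (edgeS _ _ adj wi wi1) => Sn; last by exists i.+1 => //; clear -ij; lia.
  exists i => //; rewrite ltn_neqAle; apply/andP; split; last by clear -ij; lia.
  by apply: contra noS => /eqP ->.
Qed.

(** * Connections inside a set *)

Lemma joined_in_refl (T : countType) (e : rel T) (S : set T) x :
  S x -> joined_in e S x x.
Proof. by move=> Sx; exists [::]; split => // z; rewrite inE => /eqP ->. Qed.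

Lemma joined_in_left (T : countType) (e : rel T) (S : set T) x y :
  joined_in e S x y -> S x.
Proof. by case=> p [_ _]; apply; rewrite mem_head. Qed.

Lemma joined_in_right (T : countType) (e : rel T) (S : set T) x y :
  joined_in e S x y -> S y.
Proof. by case=> p [_ <-]; apply; rewrite mem_last. Qed.

Lemma joined_in_step (T : countType) (e : rel T) (S : set T) x y z :
  joined_in e S x y -> e y z -> S z -> joined_in e S x z.
Proof.
case=> p [pp <- pS] yz Sz; exists (rcons p z); split.
- by rewrite rcons_path pp.
- by rewrite last_rcons.
- by move=> t; rewrite -rcons_cons mem_rcons inE => /orP[/eqP ->//|/pS].
Qed.

Lemma joined_in_ind (T : countType) (e : rel T) (S : set T) x (A : T -> Prop) :
  A x ->
  (forall y z, joined_in e S x y -> A y -> e y z -> S z -> A z) ->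
  forall y, joined_in e S x y -> A y.
Proof.
move=> Ax step y [p]; elim/last_ind: p y => [|p z IH] y [].
  by move=> _ <-.
rewrite rcons_path last_rcons => /andP[pp lz] <- pS.
have pS' t : t \in x :: p -> S t.
  by move=> tp; apply: pS; rewrite -rcons_cons mem_rcons inE tp orbT.
apply: (step (last x p)) => //; first by exists p.
  by apply: IH; split.
by apply: pS; rewrite -rcons_cons mem_rcons mem_head.
Qed.

Lemma joined_in_trans (T : countType) (e : rel T) (S : set T) x y z :
  joined_in e S x y -> joined_in e S y z -> joined_in e S x z.
Proof.
move=> xy; apply: (joined_in_ind _ e S y (joined_in e S x)) => // a b _.
exact: joined_in_step.
Qed.

Lemma joined_in_sym (T : countType) (e : rel T) (S : set T) x y :
  symmetric e -> joined_in e S x y -> joined_in e S y x.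
Proof.
move=> es xy; have Sx := joined_in_left _ _ _ _ _ xy.
apply: (joined_in_ind _ e S x (fun y => joined_in e S y x)) xy.
  exact: joined_in_refl.
move=> a b /joined_in_right Sa ax ab Sb.
apply: joined_in_trans ax; apply: (joined_in_step _ _ _ b b) => //.
  exact: joined_in_refl.
by rewrite es.
Qed.

(** Without an exit edge, membership in [B] would propagate along the path up to [y]. *)
Lemma joined_in_exit (T : countType) (e : rel T) (S B : set T) x y :
  joined_in e S x y -> B x -> ~ B y ->
  exists a b, [/\ joined_in e S x a, B a, ~ B b & e a b].
Proof.
move=> xy Bx nBy; apply: contrapT => noexit; apply: nBy.
apply: (joined_in_ind _ e S x B) xy => // a b xa Ba ab Sb.
by apply: contrapT => nBb; apply: noexit; exists a, b.
Qed.

(** * Graph distance in a connected graph *)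

Section GraphDistance.
Context {T : countType} {e : rel T}.
Context (e_con : forall x y, exists n, has_walk e x y n).

Lemma graph_dist_walk x y : has_walk e x y (graph_dist e x y).
Proof. by rewrite /graph_dist; case: pselect => // h; case: ex_minnP. Qed.

Lemma graph_dist_min x y n : has_walk e x y n -> (graph_dist e x y <= n)%N.
Proof.
by move=> w; rewrite /graph_dist; case: pselect => // h; case: ex_minnP => m _; apply.
Qed.

Lemma graph_dist_step x y z : e y z ->
  (graph_dist e x z <= (graph_dist e x y).+1)%N.
Proof.
move=> yz; apply: graph_dist_min; apply/asboolP.
have /asboolP[p [pp lp sp]] := graph_dist_walk x y.
exists (rcons p z); split; last by rewrite size_rcons sp.
- by rewrite rcons_path pp lp.
- by rewrite last_rcons.
Qed.

Lemma graph_dist_xx x : graph_dist e x x = 0%N.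
Proof.
apply/eqP; rewrite -leqn0; apply: graph_dist_min.
by apply/asboolP; exists [::].
Qed.

Lemma graph_dist_adj x y : e x y -> (graph_dist e x y <= 1)%N.
Proof. by move=> /(graph_dist_step x); rewrite graph_dist_xx. Qed.

Lemma adj_graph_dist x y : (graph_dist e x y <= 1)%N -> x != y -> e x y.
Proof.
have /asboolP[p [pp lp <-]] := graph_dist_walk x y.
case: p pp lp => [|a [|//]] /=; first by move=> _ ->; rewrite eqxx.
by rewrite andbT => xa <-.
Qed.

Context (e_sym : symmetric e).

Lemma graph_dist_sym x y : graph_dist e x y = graph_dist e y x.
Proof.
suff le a b : (graph_dist e a b <= graph_dist e b a)%N.
  by apply/eqP; rewrite eqn_leq !le.
apply: graph_dist_min; apply/asboolP.
have /asboolP[p [pp lp sp]] := graph_dist_walk b a.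
exists (rev (belast b p)); rewrite size_rev size_belast sp; split => //.
  rewrite -lp rev_path; apply: sub_path pp => s t /=; by rewrite e_sym.
by case: p lp {pp sp} => [|c p] //= lp; rewrite rev_cons last_rcons.
Qed.

End GraphDistance.

(** * Star-paths and crossings of [d]-balls *)

Lemma star_adj_sym (G : countType) (adj : rel G) :
  (forall x y, exists n, has_walk adj x y n) -> symmetric adj ->
  symmetric (star_adj adj).
Proof.
move=> con s x y; rewrite /star_adj eq_sym (graph_dist_sym con s).
by rewrite distrC.
Qed.

(** The path leaves the ball of radius [2 * r] by a step from [v] to [w], possibly diagonal. As the
    distance is a maximum over the two coordinates, changing a single one already leaves the ball,
    so [v] has an outside neighbor in the product graph. *)
Lemma far_star_crossing (R : realType) (G : countType) (adj : rel G) (beta : R)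
    (S : set (G * int)) (x b : G * int) (r : R) :
  (forall x y, exists n, has_walk adj x y n) -> 0 <= r ->
  joined_in (star_adj adj) S x b -> 2 * r < prod_dist adj beta x b ->
  0 < beta -> star_crossing adj beta S x r.
Proof.
move=> con r0 xb far beta0.
(* Positivity of [beta] makes the exponent nonzero; [0] to the power [0] would be [1]. *)
have dxx : prod_dist adj beta x x = 0.
  rewrite /prod_dist graph_dist_xx subrr normr0 /= powR0 ?maxxx//.
  by rewrite mulf_neq0// ?invr_neq0// gt_eqF.
have Bx t : 0 <= t -> dist_ball adj beta x t x by rewrite /dist_ball /= dxx.
have [||v [w [xv Bv nBw vw]]] := joined_in_exit _ _ _ (dist_ball adj beta x (2 * r)) _ _ xb.
- by apply: Bx; rewrite mulr_ge0.
- by rewrite /dist_ball /=; apply/negP; rewrite -ltNge.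
exists x, v; split => //; first exact: Bx.
split=> //.
move: vw Bv nBw; rewrite /star_adj /dist_ball /prod_dist /=.
case: v xv => v1 v2 xv; case: w => w1 w2 /= /and3P[_ d1 d2].
rewrite ge_max => /andP[Bv1 Bv2]; rewrite ge_max => /negP; rewrite negb_and => /orP[nB|nB].
- exists (w1, v2); last by rewrite /= ge_max (negbTE nB).
  rewrite /prod_adj /= eqxx andbT; apply/orP; left; apply: (adj_graph_dist con) => //.
  by apply: contraNneq nB => <-.
- exists (v1, w2); last by rewrite /= ge_max (negbTE nB) andbF.
  rewrite /prod_adj /= eqxx /=; apply/orP; right.
  have : v2 != w2 by apply: contraNneq nB => <-.
  lia.
Qed.

(** * The star-cluster around a finite vacant component *)

Lemma finite_set_bounded (T : choiceType) (K : set T) (f : T -> nat) :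
  finite_set K -> exists N, forall k, K k -> (f k < N)%N.
Proof.
move=> /finite_seqP[s ->]; exists (\max_(k <- s) f k).+1 => k /= ks.
by rewrite ltnS; apply: leq_bigmax_seq.
Qed.

(* B is the *-cluster of the occupied point above a topmost point of K. *)
Lemma surrounding_star_cluster (G : countType) (adj : rel G) (y : nat -> G)
    (A : set (G * int)) (x : G * int) :
  (forall x y, exists n, has_walk adj x y n) -> symmetric adj ->
  irreflexive adj -> geodesic_ray adj y ->
  let Q := range y `*` [set: int] in
  let K := component (prod_adj adj) (~` A `&` Q) x in
  finite_set K -> K x ->
  exists B : set (G * int),
    (forall a b, B a -> B b -> joined_in (star_adj adj) (A `&` Q) a b) /\
    forall n z, K (y n, z) ->
      [/\ exists k : nat, B (y n, z + k.+1%:Z),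
          exists k : nat, B (y n, z - k.+1%:Z) &
          exists2 m, (n < m)%N & B (y m, z)].
Proof.
move=> con adj_sym adj_irr yray Q K Kfin Kx.
have yinj n m : y n = y m -> n = m.
  by move=> ynm; have := yray n m; rewrite ynm graph_dist_xx; lia.
have yadj n m : adj (y n) (y m) = (n == m.+1) || (m == n.+1).
  apply/idP/idP => [a|a].
    have := graph_dist_adj con _ _ a; rewrite yray => d1.
    have : n != m by apply: contraTneq a => ->; rewrite adj_irr.
    lia.
  apply: (adj_graph_dist con); first by rewrite yray; lia.
  apply/eqP => /yinj; lia.
(* At [(y n, z)] this function equals [n + |z|], so one bound controls both coordinates. *)
have [N KN] := finite_set_bounded _ _
  (fun k => graph_dist adj (y 0%N) k.1 + `|k.2|)%N Kfin.
have {}KN n z : K (y n, z) -> (n < N)%N /\ (`|z| < N)%N.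
  by move=> /KN /=; rewrite yray; lia.
(* Rows are numbered downwards from height [N], so that row 0 lies above the component. *)
pose phi (v : nat * nat) := (y v.1, N%:Z - v.2%:Z).
have phiQ v : Q (phi v) by split => //; exists v.1.
have phi_inj v w : phi v = phi w -> v = w.
  by case: v w => [? ?] [? ?] [/yinj /= ->] ?; congr (_, _); lia.
have phi_onto q : K q -> exists v, phi v = q.
  move=> Kq; have [_ [[n _ yn] _]] := joined_in_right _ _ _ _ _ Kq.
  case: q yn Kq => q1 z /= <- Kq; exists (n, `|N%:Z - z|%N).
  by rewrite /phi /=; congr (_, _); have := KN _ _ Kq; lia.
have phi_adj v w : prod_adj adj (phi v) (phi w) = grid_adj v w.
  rewrite /prod_adj /grid_adj /phi /= yadj.
  have -> : (y v.1 == y w.1) = (v.1 == w.1).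
    by apply/eqP/eqP => [/yinj|->].
  case: v w => [? ?] [? ?] /=; lia.
pose C : pred (nat * nat) := fun v => `[< K (phi v) >].
(* A vacant neighbor of the component would belong to it, so its outer boundary is occupied. *)
have CA v w : ~~ C v -> C w -> grid_adj v w -> (A `&` Q) (phi v).
  move=> /asboolP nCv /asboolP Cw vw; split => //; apply: contrapT => nA.
  apply: nCv; apply: joined_in_step Cw _ _ => //.
  by rewrite phi_adj; move: vw; rewrite /grid_adj; lia.
have [vx vxE] := phi_onto _ Kx.
have [c [Cc ctop]] : exists c, C c /\ forall a, C a -> (c.2 <= a.2)%N.
  have exC : exists j, `[< exists n, C (n, j) >].
    exists vx.2; apply/asboolP; exists vx.1.
    by rewrite -surjective_pairing; apply/asboolP; rewrite vxE.
  case: (ex_minnP exC) => j /asboolP[n Cn] jmin; exists (n, j); split => // a Ca.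
  by apply: jmin; apply/asboolP; exists a.1; rewrite -surjective_pairing.
have row0 n : ~~ C (n, 0%N).
  by apply/negP => /asboolP /KN /=; lia.
pose o := (c.1, c.2.-1).
have cpos : (0 < c.2)%N.
  by rewrite lt0n; apply/eqP => c0; move: (row0 c.1); rewrite -c0 -surjective_pairing Cc.
have oA : (A `&` Q) (phi o).
  apply: (CA o c) => //; last by rewrite /grid_adj /o /=; lia.
  by apply/negP => /ctop /=; lia.
(* The full star-cluster of occupied points is taken, including points away from the boundary of
   [C]. *)
pose S : pred (nat * nat) := fun v =>
  `[< joined_in (star_adj adj) (A `&` Q) (phi o) (phi v) >].
have CS : boundary_closed C S.
  split=> [v /asboolP /joined_in_right [Av _]|v w t /asboolP Sv vw nCw Ct wt].
    by apply/negP => /asboolP /joined_in_right [].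
  apply/asboolP; have Aw := CA _ _ nCw Ct wt.
  have [<-//|vNw] := eqVneq v w.
  apply: joined_in_step Sv _ Aw; rewrite /star_adj /= yray.
  have -> : phi v != phi w by apply: contraNneq vNw => /phi_inj ->.
  by move: vw; rewrite /king_near /=; lia.
have Ccon : grid_connected C.
  move=> D Dadj; suff DE v : C v -> D v = D vx by move=> a b /DE -> /DE ->.
  move=> /asboolP Kv.
  apply: (joined_in_ind _ _ _ _ (fun k => forall w, phi w = k -> D w = D vx) _ _ _ Kv) => //.
    by move=> w; rewrite -vxE => /phi_inj ->.
  move=> k l Kk Dk kl Vl w wl; have [t tk] := phi_onto _ Kk.
  rewrite -(Dk t tk); apply: Dadj.
  - by apply/asboolP; rewrite wl; apply: joined_in_step Kk _ _.
  - by apply/asboolP; rewrite tk.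
  - by move: kl; rewrite -wl -tk phi_adj /grid_adj; lia.
(* Heights down to [-N] correspond to rows up to [2N]. *)
have bnd a : C a -> (a.1 < N + N)%N /\ (a.2 < N + N)%N.
  by move=> /asboolP /KN /=; lia.
have rays := boundary_meets_rays C S (N + N) c CS Ccon row0 bnd Cc ctop.
exists (joined_in (star_adj adj) (A `&` Q) (phi o)); split.
  move=> a b oa ob; apply: joined_in_trans ob.
  by apply: joined_in_sym oa; exact: star_adj_sym.
move=> n z Kz; have [v vz] := phi_onto _ Kz.
have Cv : C v by apply/asboolP; rewrite vz.
have [|[j jv /asboolP Sj] [j' jv' /asboolP Sj'] [m mv /asboolP Sm]] := rays _ _ Cv.
  by apply/asboolP; exact: joined_in_refl.
case: v vz jv jv' mv Sj Sj' Sm {Cv} => v1 v2; rewrite /phi /= => -[/yinj -> <-].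
move=> jv jv' mv Sj Sj' Sm; split; last by exists m.
- exists (v2 - j).-1; move: Sj; congr (joined_in _ _ _ (_, _)); lia.
- exists (j' - v2).-1; move: Sj'; congr (joined_in _ _ _ (_, _)); lia.
Qed.

(** The crossing starts at the point [p] of the surrounding cluster above the origin of the
    component. Writing [M] for the maximum in the radius, the cluster has a point at distance at
    least [M / 2] from [p], while twice the radius [M / 8] is only [M / 4]. *)
Lemma crossing_of_finite_component (R : realType) (G : countType)
    (adj : rel G) (beta : R) (y : nat -> G) (A : set (G * int))
    (n0 : nat) (z0 : int) (L : R) :
  (forall x y, exists n, has_walk adj x y n) -> symmetric adj ->
  irreflexive adj -> geodesic_ray adj y -> 2 <= beta -> 2 <= L ->
  let Q := range y `*` [set: int] in
  finite_component_reaches adj beta (~` A `&` Q) (y n0, z0) L ->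
  exists k : nat, star_crossing adj beta (A `&` Q) (y n0, z0 + k.+1%:Z)
    (Num.max L (k.+1%:R `^ (2 / beta)) / 8).
Proof.
move=> con adj_sym adj_irr yray beta2 L2 Q [Kfin [q [Kq [_ [q' qq' nq']]]]].
have Kx : component (prod_adj adj) (~` A `&` Q) (y n0, z0) (y n0, z0).
  by apply: joined_in_refl; exact: joined_in_left Kq.
have beta0 : 0 < beta by lra.
have s0 : 0 <= 2 / beta by rewrite divr_ge0// ltW.
have s1 : 2 / beta <= 1 by rewrite ler_pdivrMr// mul1r.
have [B [Bjoin Brays]] := surrounding_star_cluster
  _ _ _ _ _ con adj_sym adj_irr yray Kfin Kx.
have [[k Bp] [kd Bd] [m n0m Bm]] := Brays _ _ Kx.
have [_ [[n1 _ qn1] _]] := joined_in_right _ _ _ _ _ Kq.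
case: q qn1 Kq qq' => q1 z1 /= <- {q1} /Brays [[k1 Bu1] [k2 Bd1] [m1 n1m1 Bm1]] qq'.
pose p := (y n0, z0 + k.+1%:Z).
have vert (b : G * int) (h : nat) : (h <= `|p.2 - b.2|)%N ->
    h%:R `^ (2 / beta) <= prod_dist adj beta p b.
  move=> hb; rewrite /prod_dist le_max; apply/orP; right.
  apply: ge0_ler_powR; rewrite ?nnegrE ?ler0n ?ler0z ?normr_ge0//.
  by rewrite -[h%:R]/(h%:Z%:~R) ler_int; rewrite -abszE lez_nat.
have far1 : exists2 b, B b & k.+1%:R `^ (2 / beta) <= prod_dist adj beta p b.
  exists (y n0, z0 - kd.+1%:Z) => //; apply: vert; rewrite /p /=; lia.
have far2 : exists2 b, B b & L / 2 <= prod_dist adj beta p b.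
  (* The loss of 1 in passing to the outside neighbor [q'] of [q] is absorbed by [L >= 2]. *)
  have hor n z : B (y n, z) -> L <= `|n0%:Z - n%:Z|%N.+1%:R ->
      exists2 b, B b & L / 2 <= prod_dist adj beta p b.
    move=> Bn Ln; exists (y n, z) => //; rewrite /prod_dist le_max /= yray.
    by apply/orP; left; rewrite -natr1 in Ln; lra.
  (* Since [2 / beta <= 1], doubling a height multiplies its power by at most 2. *)
  have ver b (h : nat) : B b -> (h <= `|p.2 - b.2|.*2)%N -> L <= h%:R `^ (2 / beta) ->
      exists2 b, B b & L / 2 <= prod_dist adj beta p b.
    move=> Bb hb Lh; exists b => //; rewrite ler_pdivrMr//.
    apply: (le_trans Lh).
    apply: (@le_trans _ _ ((`|p.2 - b.2|%N%:R * 2) `^ (2 / beta))).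
      apply: ge0_ler_powR => //; rewrite ?nnegrE ?mulr_ge0 ?ler0n//.
      by rewrite -natrM ler_nat muln2.
    rewrite powRM ?ler0n// ler_pM ?powR_ge0//; first exact: vert.
    by rewrite -[leRHS]powRr1// ler_powR// ler1n.
  move: nq'; rewrite /dist_ball /= => /negP; rewrite -ltNge lt_max.
  case: q' qq' => q1 z' /= qq'.
  have [dq dz] : (graph_dist adj (y n0) q1 <= `|n0%:Z - n1%:Z|.+1)%N /\
      (`|z0 - z'| <= `|z0 - z1|.+1)%N.
    move: qq'; rewrite /prod_adj /= => /orP[] /andP[].
      move=> /(graph_dist_step con (y n0)); rewrite yray => d1 /eqP <-.
      by split; [exact: d1|exact: leqnSn].
    by move=> /eqP <-; rewrite yray => d1; split; lia.
  case/orP => [far|far].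
    have {}far : L <= `|n0%:Z - n1%:Z|.+1%:R.
      by apply: (le_trans (ltW far)); rewrite ler_nat.
    have [n01|n10] := leqP n0 n1.
      apply: (hor _ _ Bm1); apply: (le_trans far); rewrite ler_nat; lia.
    by apply: (hor _ _ Bu1).
  have {}far : L <= `|z0 - z'|%N%:R `^ (2 / beta).
    by apply: (le_trans (ltW far)); rewrite -[X in _ <= X `^ _]/(_%:Z%:~R) abszE.
  have [z01|z10] := lerP z0 z1; last first.
    by apply: (ver _ _ Bd1 _ far); rewrite /p /=; lia.
  (* When [q] is not below the origin, [p] may be close to the cluster point above [q]. If so, [k]
     is large and the cluster point below the origin is far from [p]. *)
  have [kk|kk] := leqP (`|z0 - z'|)%N k.+2.*2.
    by apply: (ver _ _ Bd _ far); rewrite /p /=; lia.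
  by apply: (ver _ _ Bu1 _ far); rewrite /p /=; lia.
have [b Bb bfar] : exists2 b, B b &
    Num.max L (k.+1%:R `^ (2 / beta)) / 2 <= prod_dist adj beta p b.
  case: (leP L (k.+1%:R `^ (2 / beta))) => // _.
  have [b Bb kb] := far1; exists b => //.
  by apply: le_trans kb; rewrite ler_pdivrMr// ler_peMr ?powR_ge0// ler1n.
exists k; have M0 : 0 < Num.max L (k.+1%:R `^ (2 / beta)).
  by rewrite lt_max; apply/orP; left; lra.
apply: (far_star_crossing _ _ _ _ _ _ b) => //; [lra|exact: Bjoin|].
by apply: lt_le_trans bfar; lra.
Qed.

(** * Measurability of the events *)

Section MeasurableEvents.
Context {d : measure_display} {Omega : measurableType d}.

(** Stated for predicates, so that measurability follows the logical structure of the event. *)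
Definition event (A : Omega -> Prop) := measurable [set o | A o].

Lemma event_const (A : Prop) : event (fun=> A).
Proof.
rewrite /event; have [a|na] := pselect A.
- by rewrite (_ : [set o | A] = setT)//; apply/seteqP; split.
- by rewrite (_ : [set o | A] = set0)//; apply/seteqP; split.
Qed.

Lemma event_not A : event A -> event (fun o => ~ A o).
Proof. exact: measurableC. Qed.

Lemma event_and A B : event A -> event B -> event (fun o => A o /\ B o).
Proof. exact: measurableI. Qed.

Lemma event_ex (T : countType) (A : T -> Omega -> Prop) :
  (forall t, event (A t)) -> event (fun o => exists t, A t o).
Proof.
move=> mA; rewrite /event (_ : [set o | _] = \bigcup_t [set o | A t o]).
  exact: countable_bigcupT_measurable.
by apply/seteqP; split => o [t] *; exists t.
Qed.

Lemma event_all (T : countType) (A : T -> Omega -> Prop) :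
  (forall t, event (A t)) -> event (fun o => forall t, A t o).
Proof.
move=> mA; rewrite /event (_ : [set o | _] = [set o | ~ exists t, ~ A t o]).
  by apply: event_not; apply: event_ex => t; exact: event_not.
apply/seteqP; split => o /= H; first by case=> t; apply.
by move=> t; apply: contrapT => nA; apply: H; exists t.
Qed.

Lemma event_imply A B : event A -> event B -> event (fun o => A o -> B o).
Proof.
move=> mA mB; rewrite /event (_ : [set o | _] = [set o | ~ (A o /\ ~ B o)]).
  by apply: event_not; apply: event_and => //; exact: event_not.
apply/seteqP; split => o /= H; first by case=> /H.
by move=> Ao; apply: contrapT => nB; apply: H.
Qed.

(** Paths are finite sequences in a countable type, so the existential is a countable union. *)
Lemma event_joined_in (T : countType) (e : rel T) (S : Omega -> set T) x y :
  (forall t, event (S^~ t)) -> event (fun o => joined_in e (S o) x y).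
Proof.
move=> mS; apply: event_ex => p.
rewrite /event (_ : [set o | _] = [set o | (path e x p /\ last x p = y) /\
  forall z, z \in x :: p -> S o z]).
  apply: event_and; first exact: event_const.
  by apply: event_all => z; apply: event_imply => //; exact: event_const.
by apply/seteqP; split => o /= => [[]|[[]]].
Qed.

Lemma event_star_crossing (R : realType) (G : countType) (adj : rel G)
    (beta : R) (S : Omega -> set (G * int)) x L :
  (forall t, event (S^~ t)) ->
  event (fun o => star_crossing adj beta (S o) x L).
Proof.
move=> mS; apply: event_ex => a; apply: event_ex => b.
rewrite /event (_ : [set o | _] = [set o | (dist_ball adj beta x L a /\
  interior_boundary (prod_adj adj) (dist_ball adj beta x (2 * L)) b) /\
  joined_in (star_adj adj) (S o) a b]).
  by apply: event_and; [exact: event_const|exact: event_joined_in].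
by apply/seteqP; split => o /= => [[]|[[]]].
Qed.

(** Finiteness of the component means that some finite list contains it, which involves only
    countable quantifiers. *)
Lemma event_finite_component_reaches (R : realType) (G : countType)
    (adj : rel G) (beta : R) (S : Omega -> set (G * int)) x L :
  (forall t, event (S^~ t)) ->
  event (fun o => finite_component_reaches adj beta (S o) x L).
Proof.
move=> mS; apply: event_and; last first.
  apply: event_ex => q; apply: event_and; last exact: event_const.
  exact: event_joined_in.
rewrite /event (_ : [set o | _] = [set o | exists s : seq (G * int),
    forall q, component (prod_adj adj) (S o) x q -> q \in s]).
  apply: event_ex => s; apply: event_all => q.
  by apply: event_imply; [exact: event_joined_in|exact: event_const].
apply/seteqP; split => o /=.
  by move=> /finite_seqP[s ->]; exists s.
by move=> [s sub]; apply: sub_finite_set (finite_seq s).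
Qed.

End MeasurableEvents.

(** * Summability of stretched exponentials *)

Lemma stretched_exp_summable (R : realType) (c t : R) : 0 < c -> 0 < t ->
  exists2 C : R, 0 < C & forall n : nat,
    \sum_(0 <= k < n) expR (- (c * k.+1%:R `^ t)) <= C.
Proof.
move=> c0 t0.
(* With this [m], the term of order [m.+1] of the exponential series grows at least like the square
   of [k.+1]. *)
have [m tm] : exists m : nat, 2 <= t * m.+1%:R.
  exists (Num.truncn (2 / t)); rewrite mulrC -ler_pdivrMr//.
  exact: ltW (truncnS_gt _).
have [D D0 DE] : exists2 D : R, 0 < D & D = (m.+1)`!%:R / c ^+ m.+1.
  by eexists; last reflexivity; rewrite divr_gt0 ?exprn_gt0// ltr0n fact_gt0.
(* The bound [D / a ^+ 2] is at most the telescoping term because [a + 1 <= 2 * a]. *)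
have bnd k : expR (- (c * k.+1%:R `^ t)) <= 2 * D * (k.+1%:R^-1 - k.+2%:R^-1).
  set a : R := k.+1%:R; have a1 : 1 <= a by rewrite ler1n.
  have a0 : 0 < a by lra.
  have sq : a ^+ 2 <= (a `^ t) ^+ m.+1.
    by rewrite -!powR_mulrn ?powR_ge0 ?(ltW a0)// -powRrM ler_powR.
  have e1 : (c * a `^ t) ^+ m.+1 / (m.+1)`!%:R <= expR (c * a `^ t).
    apply: le_trans (expR_ge1Dxn m _); first by rewrite lerDr.
    by rewrite mulr_ge0 ?powR_ge0 ?ltW.
  have e2 : a ^+ 2 / D <= expR (c * a `^ t).
    apply: le_trans e1; rewrite DE exprMn invf_div mulrA ler_pM2r.
      by rewrite mulrC ler_pM2l ?exprn_gt0.
    by rewrite invr_gt0 ltr0n fact_gt0.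
  rewrite expRN -(natr1 k.+1) -/a.
  apply: (@le_trans _ _ (D / a ^+ 2)).
    rewrite -[leRHS]invrK invf_div lef_pV2 ?posrE ?expR_gt0//.
    by rewrite divr_gt0// exprn_gt0.
  have -> : a^-1 - (a + 1)^-1 = (a * (a + 1))^-1 by field; lra.
  have -> : 2 * D * (a * (a + 1))^-1 = D * (2 / (a * (a + 1))).
    by rewrite (mulrC 2 D) -(mulrA D).
  rewrite ler_pM2l// ler_pdivlMr; last by rewrite mulr_gt0//; lra.
  rewrite ler_pdivrMl ?exprn_gt0//; nra.
exists (2 * D) => [|n]; first by rewrite mulr_gt0.
have tele : \sum_(0 <= k < n) expR (- (c * k.+1%:R `^ t)) <=
    2 * D * (1 - n.+1%:R^-1).
  elim: n => [|n IH]; first by rewrite big_geq// invr1 subrr mulr0.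
  rewrite big_nat_recr//=.
  by have := lerD IH (bnd n); rewrite -mulrDr addrA subrK.
by apply: (le_trans tele); rewrite -[leRHS]mulr1 ler_pM2l ?mulr_gt0.
Qed.

Theorem corollary5p5
  (R : realType) (G : countType) (adj : rel G) (rho : G -> G -> R)
  (HG : infinite_bounded_degree_graph adj)
  (Hrho : elliptic_weight adj rho)
  (alpha : R) (Halpha : 1 < alpha) (Hvol : volume_growth adj rho alpha)
  (dW : measure_display) (W : measurableType dW)
  (PW : G * int -> probability W R) (X : nat -> W -> G * int)
  (HX : is_random_walk (prod_adj adj) (prod_weight adj rho) PW X)
  (beta : R) (Hbeta : 2 <= beta <= 1 + alpha)
  (Hgreen : green_bounds adj beta (alpha - beta / 2)
     (green (prod_adj adj) (prod_weight adj rho) PW X))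
  (dO : measure_display) (Omega : measurableType dO)
  (P : probability Omega R) (I : R -> Omega -> set (G * int))
  (HI : are_interlacements
     (capacity (prod_adj adj) (prod_weight adj rho) PW X) P I)
  (u : R) (Hu0 : 0 <= u) (Hu : (u%:E < u_tilde adj beta P I)%E)
  (kappa : R) (Hkappa : 0 < kappa < 1)
  (Hcross : exists c6 c7 : R, [/\ 0 < c6, 0 < c7 & forall L : R, 1 <= L ->
     (sup_star_crossing adj beta P I u L
        <= (c6 * expR (- (c7 * L `^ kappa)))%:E)%E]) :
  exists c8 c9 : R, [/\ 0 < c8, 0 < c9 & forall L : R, 1 <= L ->
     (sup_finite_component adj beta P I u L
        <= (c8 * expR (- (c9 * L `^ kappa)))%:E)%E].
Proof.
have con := graph_connected HG.
have adj_sym := graph_sym HG.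
have adj_irr := graph_irrefl HG.
have [beta2 _] := andP Hbeta.
have [kappa0 _] := andP Hkappa.
have [c6 [c7 [c6_gt0 c7_gt0 cross]]] := Hcross.
have mI : forall t, measurable [set o | I u o t].
  by move=> t; exact: interlacement_measurable HI u t Hu0.
(* The power of [8^-1] comes from the radius [M / 8]. The factor 1/2 comes from bounding the
   [kappa]-power of a maximum below by the mean of the two powers, which splits the bound into decay
   in [L] and a summable factor in [k]. *)
pose c9 : R := c7 * (8^-1 `^ kappa) / 2.
have c9_gt0 : 0 < c9 by rewrite !mulr_gt0 ?powR_gt0.
have theta_gt0 : 0 < 2 / beta * kappa by rewrite mulr_gt0// divr_gt0//; lra.
have [C C_gt0 sumC] := stretched_exp_summable R c9 _ c9_gt0 theta_gt0.
(* The first summand serves [L >= 8]; the second makes the bound at least 1 when [L < 8], where the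
   crossing radius may fall below 1. *)
exists (c6 * C + expR (c9 * 8 `^ kappa)), c9; split => //.
  by rewrite addr_gt0 ?mulr_gt0 ?expR_gt0.
move=> L L1; apply: ge_ereal_sup => _ [_ [x [[y yray ->] Qx ->]]].
set Q := range y `*` [set: int] in Qx *.
have mV t : event (fun o => (~` I u o `&` Q) t).
  by apply: event_and; [apply: event_not; exact: mI|exact: event_const].
have mIQ t : event (fun o => (I u o `&` Q) t).
  by apply: event_and; [exact: mI|exact: event_const].
have mreach := event_finite_component_reaches R G adj beta _ x L mV.
have [L8|L8] := ltP L 8.
  apply: (le_trans (probability_le1 P mreach)); rewrite lee_fin mulrDl.
  rewrite ler_wpDl ?mulr_ge0 ?expR_ge0 ?(ltW c6_gt0) ?(ltW C_gt0)//.
  rewrite -expRD; apply: le_trans (expR_ge1Dx _); rewrite lerDl -mulrBr.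
  rewrite mulr_ge0 ?(ltW c9_gt0)// subr_ge0.
  by apply: ge0_ler_powR; rewrite ?nnegrE; lra.
case: x Qx mreach => x1 z [[n _ /= <-] _] mreach.
pose r (k : nat) : R := Num.max L (k.+1%:R `^ (2 / beta)) / 8.
pose F (k : nat) :=
  [set o | star_crossing adj beta (I u o `&` Q) (y n, z + k.+1%:Z) (r k)].
have mF k : measurable (F k) by exact: event_star_crossing.
have PF k : (P (F k) <= (c6 * expR (- (c9 * L `^ kappa)) *
    expR (- (c9 * k.+1%:R `^ (2 / beta * kappa))))%:E)%E.
  have r1 : 1 <= r k by rewrite /r ler_pdivlMr// mul1r le_max L8.
  (* The crossing is centered at a point depending on [k]; the supremum over all centers makes the
     hypothesis uniform. *)
  apply: le_trans (_ : (sup_star_crossing adj beta P I u (r k) <= _)%E).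
    apply: ereal_sup_ubound; exists Q, (y n, z + k.+1%:Z); split => //.
    by exists y.
  apply: (le_trans (cross _ r1)); rewrite lee_fin -mulrA ler_pM2l// -expRD.
  rewrite ler_expR -opprD lerN2 -mulrDr /c9 mulrAC -mulrA -[leLHS]mulrA ler_pM2l//.
  set T := _ `^ (2 / beta * kappa); set e := _ `^ kappa.
  have M0 : 0 <= Num.max L (k.+1%:R `^ (2 / beta)) by rewrite le_max powR_ge0 orbT.
  rewrite /r powRM// [leRHS]mulrC ler_wpM2l ?powR_ge0//.
  have LM : L `^ kappa <= Num.max L (k.+1%:R `^ (2 / beta)) `^ kappa.
    by apply: ge0_ler_powR; rewrite ?nnegrE ?le_max ?lexx//; lra.
  have TM : T <= Num.max L (k.+1%:R `^ (2 / beta)) `^ kappa.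
    rewrite /T powRrM.
    by apply: ge0_ler_powR; rewrite ?nnegrE ?powR_ge0 ?le_max ?lexx ?orbT//; lra.
  lra.
(* Union bound over the height at which the cluster meets the upward ray. *)
apply: (@le_trans _ _ (\sum_(0 <= k <oo) P (F k))%E).
  apply: measure_sigma_subadditive => // o reach.
  have [|k cr] := crossing_of_finite_component R G adj beta y (I u o) n z L
    con adj_sym adj_irr yray beta2 _ reach; first lra.
  by exists k.
apply: lime_le; first by apply: is_cvg_nneseries.
apply: nearW => m.
apply: (@le_trans _ _ (\sum_(0 <= k < m) (c6 * expR (- (c9 * L `^ kappa)) *
    expR (- (c9 * k.+1%:R `^ (2 / beta * kappa))))%:E)%E).
  exact: lee_sum.
rewrite sumEFin lee_fin -mulr_sumr.
apply: (@le_trans _ _ (c6 * expR (- (c9 * L `^ kappa)) * C)).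
  by rewrite ler_wpM2l// mulr_ge0 ?expR_ge0 ?ltW.
by rewrite mulrAC ler_wpM2r ?expR_ge0// lerDl expR_ge0.
Qed.
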